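(* Let $\mathbb P$ be a finite partition with $|\mathbb P|=n$ and let $(\underline P,\overline P)$ be a Horizontal Barrier Model on $\mathcal A(\mathbb P)$. If $\underline P$ and $\overline P$ are coherent on $\mathcal A(\mathbb P)$, then $(\underline P,\overline P)$ is the extended probability interval of the probability interval $\mathcal I=(\underline P|_{\mathbb P},\overline P|_{\mathbb P})$.
   Context: A partition $\mathbb P$ is a set of pairwise disjoint non-impossible events (atoms) whose logical sum is the sure event $\Omega$; here $\mathbb P=\{\omega_1,\dots,\omega_n\}$. $\mathcal A(\mathbb P)$ is the powerset of $\mathbb P$ (events are identified with sets of atoms); $\emptyset$ is the impossible event, $\neg$ is complement, and $\omega_i\Rightarrow A$ means that the atom $\omega_i$ belongs to $A$. A probability on $\mathcal A(\mathbb P)$ is an additive function $P_0:\mathcal A(\mathbb P)\to[0,1]$ with $P_0(\Omega)=1$. $I_A$ is the indicator of $A$; maxima of gains are over atoms; $\mathbb N$ includes $0$. A Horizontal Barrier Model (HBM) is a pair $(\underline P,\overline P)$ of maps $\mathcal A(\mathbb P)\to\mathbb R$ determined by a probability $P_0$ on $\mathcal A(\mathbb P)$ and reals $a$, $b>0$ with $a+b>1$ and $b+2a\le 1$ (hence $a<0$, $b>1$), with $c=1-(a+b)<0$: for all $A\in\mathcal A(\mathbb P)\setminus\{\emptyset,\Omega\}$, $\underline P(A)=\min\{\max\{bP_0(A)+a,0\},1\}$ and $\overline P(A)=\max\{\min\{bP_0(A)+c,1\},0\}$, while $\underline P(\emptyset)=\overline P(\emptyset)=0$ and $\underline P(\Omega)=\overline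 P(\Omega)=1$. $\underline P$ is a coherent lower probability if for all $n\in\mathbb N$, $s_i\ge 0$, $A_i\in\mathcal A(\mathbb P)$ ($i=0,\dots,n$), $\max\big[\sum_{i=1}^n s_i(I_{A_i}-\underline P(A_i))-s_0(I_{A_0}-\underline P(A_0))\big]\ge 0$. $\overline P$ is a coherent upper probability if for all such $n,s_i,A_i$, $\max\big[\sum_{i=1}^n s_i(\overline P(A_i)-I_{A_i})-s_0(\overline P(A_0)-I_{A_0})\big]\ge 0$. Extended probability interval: with $l_i=\underline P(\omega_i)$, $u_i=\overline P(\omega_i)$, the extended probability interval of $\mathcal I$ is the pair $(l,u)$ of functions on $\mathcal A(\mathbb P)$ given by $l(A)=\max\{\sum_{\omega_i\Rightarrow A}l_i,\ 1-\sum_{\omega_i\Rightarrow\neg A}u_i\}$ and $u(A)=1-l(\neg A)=\min\{\sum_{\omega_i\Rightarrow A}u_i,\ 1-\sum_{\omega_i\Rightarrow\neg A}l_i\}$. The conclusion means $\underline P(A)=l(A)$ and $\overline P(A)=u(A)$ for all $A\in\mathcal A(\mathbb P)$. *)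

(* Defs.v *)
From mathcomp Require Import all_boot all_order all_algebra.
From mathcomp Require Import reals.

Set Implicit Arguments.
Unset Strict Implicit.
Unset Printing Implicit Defensive.
Import Order.TTheory GRing.Theory Num.Theory.
Local Open Scope ring_scope.

(* The atoms of the partition are the elements of a finType [T]; events are
   sets of atoms, so [set0] is impossible, [setT] is sure, [~: A] is "not A"
   and the atom [w], seen as an event, is [[set w]]. *)

Section HorizontalBarrierModels.
Variables (R : realType) (T : finType).
Implicit Types (A B : {set T}) (P lP uP : {set T} -> R) (w : T).

(* The value 0 is only taken when [T] is empty. *)
Definition max_atoms (G : T -> R) : R :=
  if [pick w : T] is Some w0 then \big[Num.max/G w0]_(w : T) G w else 0.

Lemma max_atoms_ge (G : T -> R) w : G w <= max_atoms G.
Proof.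
rewrite /max_atoms; case: pickP => [w0 _|/(_ w)//].
exact: le_bigmax.
Qed.

Lemma max_atoms_attained (G : T -> R) w : exists w', max_atoms G = G w'.
Proof.
rewrite /max_atoms; case: pickP => [w0 _|/(_ w)//].
elim/big_ind: _ => [|x y [i ->] [j ->]|i _]; [by exists w0| |by exists i].
by rewrite /Num.max; case: ifP => _; [exists j|exists i].
Qed.

Definition indicator A w : R := (w \in A)%:R.

Definition probability P : Prop :=
  [/\ forall A, 0 <= P A <= 1,
      P [set: T] = 1
    & forall A B, [disjoint A & B] -> P (A :|: B) = P A + P B].

Definition HBM lP uP : Prop :=
  exists (P0 : {set T} -> R) (a b : R),
    let c := 1 - (a + b) in
    [/\ probability P0,
        [/\ 0 < b, 1 < a + b & b + 2 * a <= 1],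
        forall A, A != set0 -> A != [set: T] ->
          lP A = Num.min (Num.max (b * P0 A + a) 0) 1 /\
          uP A = Num.max (Num.min (b * P0 A + c) 1) 0,
        lP set0 = 0 /\ uP set0 = 0
      & lP [set: T] = 1 /\ uP [set: T] = 1].

Definition coherent_lower lP : Prop :=
  forall (n : nat) (s : nat -> R) (A : nat -> {set T}),
    (forall i, (i <= n)%N -> 0 <= s i) ->
    0 <= max_atoms (fun w =>
           \sum_(1 <= i < n.+1) s i * (indicator (A i) w - lP (A i))
           - s 0%N * (indicator (A 0%N) w - lP (A 0%N))).

Definition coherent_upper uP : Prop :=
  forall (n : nat) (s : nat -> R) (A : nat -> {set T}),
    (forall i, (i <= n)%N -> 0 <= s i) ->
    0 <= max_atoms (fun w =>
           \sum_(1 <= i < n.+1) s i * (uP (A i) - indicator (A i) w)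
           - s 0%N * (uP (A 0%N) - indicator (A 0%N) w)).

Definition restr_atoms P : T -> R := fun w => P [set w].

(* Extension to all events of the probability interval given by the lower and
   upper values [l] and [u] on the atoms. *)
Definition ext_lower (l u : T -> R) A : R :=
  Num.max (\sum_(w in A) l w) (1 - \sum_(w in ~: A) u w).

Definition ext_upper (l u : T -> R) A : R := 1 - ext_lower l u (~: A).

Lemma ext_upperE (l u : T -> R) A :
  ext_upper l u A = Num.min (\sum_(w in A) u w) (1 - \sum_(w in ~: A) l w).
Proof.
by rewrite /ext_upper /ext_lower setCK oppr_max addr_minr subKr minC.
Qed.

Definition is_extended_probability_interval (l u : T -> R) lP uP : Prop :=
  forall A, lP A = ext_lower l u A /\ uP A = ext_upper l u A.

End HorizontalBarrierModels.

(* Main.v *)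
Require Import Defs.
From mathcomp Require Import all_boot all_order all_algebra.
From mathcomp Require Import reals.
From mathcomp Require Import lra.

Set Implicit Arguments.
Unset Strict Implicit.
Unset Printing Implicit Defensive.
Import Order.TTheory GRing.Theory Num.Theory.
Local Open Scope ring_scope.

(** The model is self-conjugate, [lP A = 1 - uP (~: A)], so the claim reduces
    to [lP A = max (sum of lP over the atoms of A) (1 - sum of uP over the
    atoms of ~: A)].

    The inequality [>=] holds for any conjugate coherent pair: coherence with
    unit stakes makes [lP] superadditive on disjoint events
    ([coherent_lower_sum]) and [uP] subadditive on covers
    ([coherent_upper_sum]).

    The inequality [<=] comes from a collision between coherence and the affine
    shape of the barrier.  Put [E := ~: A]; only the case [0 < uP E < 1] needs
    this collision.  Where the truncation is inactive [uP] is [b * P0 + c],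
    with [P0] additive and [c < 0].  Splitting [E] into two disjoint parts of positive
    upper probability would count the negative constant [c] twice, so the two
    parts together would have less than [uP E], against subadditivity
    ([HBM_no_split]).  Hence [E] has an atom [w] such that [E :\ w] has upper
    probability [0], so [uP E = uP [set w]] is already accounted for by the
    atoms, and [lP A = 1 - uP E] is the second term of the maximum. *)

(** Index [0] of the sequence of bets is the event that is bet against. *)
Lemma sum_nth_cons (R : realType) (I : Type) (F : I -> R) (x : I) (s : seq I) :
  \sum_(1 <= i < (size s).+1) 1 * F (nth x (x :: s) i) = \sum_(y <- s) F y.
Proof.
by rewrite big_add1 (big_nth x); apply: eq_bigr => i _; rewrite mul1r.
Qed.

(** If the gambler's total bet pays at most [indicator B], then buying it at
    the prices [lP] while selling [B] must not be a sure loss.  A witness atom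
    is needed since the maximum of a gain over no atoms is [0]. *)
Lemma coherent_lower_sum (R : realType) (T : finType) (lP : {set T} -> R)
    (w0 : T) (s : seq {set T}) (B : {set T}) :
  coherent_lower lP ->
  (forall w, \sum_(C <- s) indicator R C w <= indicator R B w) ->
  \sum_(C <- s) lP C <= lP B.
Proof.
move=> coh le_ind.
have := coh (size s) (fun=> 1) (nth B (B :: s)) (fun _ _ => ler01).
set G := fun w => _; have [w ->] := max_atoms_attained G w0; rewrite /G /=.
rewrite (sum_nth_cons (fun C => indicator R C w - lP C)) sumrB.
by have := le_ind w; lra.
Qed.

(** The mirror image: selling a cover of [B] at the prices [uP] while buying
    [B] must not be a sure loss. *)
Lemma coherent_upper_sum (R : realType) (T : finType) (uP : {set T} -> R)
    (w0 : T) (s : seq {set T}) (B : {set T}) :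
  coherent_upper uP ->
  (forall w, indicator R B w <= \sum_(C <- s) indicator R C w) ->
  uP B <= \sum_(C <- s) uP C.
Proof.
move=> coh le_ind.
have := coh (size s) (fun=> 1) (nth B (B :: s)) (fun _ _ => ler01).
set G := fun w => _; have [w ->] := max_atoms_attained G w0; rewrite /G /=.
rewrite (sum_nth_cons (fun C => uP C - indicator R C w)) sumrB.
by have := le_ind w; lra.
Qed.

Lemma coherent_upper_mono (R : realType) (T : finType) (uP : {set T} -> R)
    (w0 : T) (A B : {set T}) :
  coherent_upper uP -> A \subset B -> uP A <= uP B.
Proof.
move=> coh sAB; have := @coherent_upper_sum _ _ _ w0 [:: B] A coh.
rewrite big_seq1; apply=> w; rewrite big_seq1 /indicator ler_nat.
by case: (boolP (w \in A)) => // /(subsetP sAB) ->.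
Qed.

Lemma coherent_upper_setU (R : realType) (T : finType) (uP : {set T} -> R)
    (w0 : T) (A B : {set T}) :
  coherent_upper uP -> uP (A :|: B) <= uP A + uP B.
Proof.
move=> coh; have := @coherent_upper_sum _ _ _ w0 [:: A; B] (A :|: B) coh.
rewrite !big_cons big_nil addr0; apply=> w.
rewrite !big_cons big_nil addr0 /indicator -natrD ler_nat inE.
by case: (w \in A) (w \in B) => [] [].
Qed.

Lemma sum_indicator_atoms (R : realType) (T : finType) (A : {set T}) (w : T) :
  \sum_(v in A) indicator R [set v] w = indicator R A w.
Proof.
rewrite /indicator; have [wA|wA] := boolP (w \in A).
  rewrite (bigD1 w) //= set11 big1 ?addr0 // => v /andP[_ /negPf vw].
  by rewrite inE eq_sym vw.
by rewrite big1 // => v vA; rewrite inE; case: eqVneq wA => // ->; rewrite vA.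
Qed.

Lemma coherent_lower_atoms (R : realType) (T : finType) (lP : {set T} -> R)
    (w0 : T) (A : {set T}) :
  coherent_lower lP -> \sum_(w in A) lP [set w] <= lP A.
Proof.
move=> coh.
have := @coherent_lower_sum _ _ _ w0 [seq [set w] | w <- enum A] A coh.
rewrite big_map big_enum; apply=> w.
by rewrite big_map big_enum /= sum_indicator_atoms.
Qed.

Lemma coherent_upper_atoms (R : realType) (T : finType) (uP : {set T} -> R)
    (w0 : T) (A : {set T}) :
  coherent_upper uP -> uP A <= \sum_(w in A) uP [set w].
Proof.
move=> coh.
have := @coherent_upper_sum _ _ _ w0 [seq [set w] | w <- enum A] A coh.
rewrite big_map big_enum; apply=> w.
by rewrite big_map big_enum /= sum_indicator_atoms.
Qed.

(** Supplies the witness atom from which the consequences of coherence start: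
    without atoms [set0] and [setT] coincide, and so would [0] and [1]. *)
Lemma HBM_inhabited (R : realType) (T : finType) (lP uP : {set T} -> R) :
  HBM lP uP -> T.
Proof.
case: (pickP (fun _ : T => true)) => [w //|T0 hHBM]; exfalso.
case: hHBM => P0 [a [b [_ _ _ [l0 _] [l1 _]]]].
have TE : [set: T] = set0 by apply/setP => w; have := T0 w.
by move: l1; rewrite TE l0 => /esym/eqP; rewrite oner_eq0.
Qed.

(** The choice [c = 1 - (a + b)] makes the reflection [t |-> 1 - t] exchange
    the two affine functions, and it exchanges the two truncations as well. *)
Lemma HBM_conjugate (R : realType) (T : finType) (lP uP : {set T} -> R) A :
  HBM lP uP -> lP A = 1 - uP (~: A).
Proof.
move=> [P0 [a [b [[_ P1 PU] _ hA [l0 u0] [l1 u1]]]]].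
have [->|A0] := eqVneq A set0; first by rewrite setC0 l0 u1 subrr.
have [->|AT] := eqVneq A [set: T]; first by rewrite setCT l1 u0 subr0.
have C0 : ~: A != set0 by rewrite -setCT (inj_eq (@setC_inj T)).
have CT : ~: A != [set: T] by rewrite -setC0 (inj_eq (@setC_inj T)).
rewrite (hA A A0 AT).1 (hA _ C0 CT).2.
have PC : P0 (~: A) = 1 - P0 A.
  have := PU A (~: A); rewrite setUCr P1 => -> //; first by lra.
  by rewrite -setI_eq0 setICr.
have -> : b * P0 (~: A) + (1 - (a + b)) = 1 - (b * P0 A + a).
  by rewrite PC; lra.
by rewrite /Num.min /Num.max; do ! case: ifPn; lra.
Qed.

(** Away from the truncations [uP] is [b * P0 + c] with [P0] additive, and two
    disjoint events contribute [c < 0] twice, their union only once. *)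
Lemma HBM_no_split (R : realType) (T : finType) (lP uP : {set T} -> R)
    (A B : {set T}) :
  HBM lP uP -> [disjoint A & B] -> uP (A :|: B) < 1 -> 0 < uP A -> 0 < uP B ->
  uP A + uP B < uP (A :|: B).
Proof.
move=> [P0 [a [b [[_ _ PU] [_ ab _] hA [_ u0] [_ u1]]]]] dAB.
have [/[dup] + ->|UT ltU ltA ltB] := eqVneq (A :|: B) [set: T].
  by rewrite u1 ltxx.
have A0 : A != set0 by apply: contraTneq ltA => ->; rewrite u0 ltxx.
have B0 : B != set0 by apply: contraTneq ltB => ->; rewrite u0 ltxx.
have AT : A != [set: T] by apply: contraNneq UT => ->; rewrite setTU.
have BT : B != [set: T] by apply: contraNneq UT => ->; rewrite setUT.
have U0 : A :|: B != set0 by rewrite setU_eq0 negb_and A0.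
move: ltU ltA ltB.
rewrite (hA _ A0 AT).2 (hA _ B0 BT).2 (hA _ U0 UT).2 (PU _ _ dAB) mulrDr.
by rewrite /Num.min /Num.max; do ! case: ifPn; lra.
Qed.

(** If no atom of [E] has positive upper probability, subadditivity gives
    [uP E = 0].  Otherwise [HBM_no_split] leaves upper probability [0] for the
    event obtained by removing a positive atom [w], so [w] carries all of
    [uP E]. *)
Lemma HBM_upper_sum_atoms (R : realType) (T : finType)
    (lP uP : {set T} -> R) (E : {set T}) :
  HBM lP uP -> coherent_upper uP -> uP E < 1 ->
  uP E = \sum_(w in E) uP [set w].
Proof.
move=> hHBM coh ltE1; have w0 := HBM_inhabited hHBM.
have u0 : uP set0 = 0 by case: hHBM => P0 [a [b [_ _ _ [_ ->]]]].
have u_ge0 A : 0 <= uP A.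
  by rewrite -u0; apply: coherent_upper_mono w0 _ _ coh (sub0set A).
apply/eqP; rewrite eq_le coherent_upper_atoms //=.
case: (pickP [pred w in E | 0 < uP [set w]]) => [w /andP[/= wE w_gt0]|E0].
  have [rest0|rest_gt0] := leP (uP (E :\ w)) 0.
    rewrite (big_setD1 w) //= big1 ?addr0 => [|v vE].
      by apply: (coherent_upper_mono w0 coh); rewrite sub1set.
    apply: le_anti; rewrite u_ge0 andbT; apply: le_trans rest0.
    by apply: (coherent_upper_mono w0 coh); rewrite sub1set.
  have dw : [disjoint [set w] & E :\ w] by rewrite disjoints1 setD11.
  have := HBM_no_split hHBM dw; rewrite setD1K // => /(_ ltE1 w_gt0 rest_gt0).
  have := coherent_upper_setU w0 [set w] (E :\ w) coh.
  by rewrite setD1K // leNgt => /negP.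
rewrite big1 // => w wE; apply: le_anti; rewrite u_ge0 andbT leNgt.
by have /= := E0 w; rewrite wE => /= ->.
Qed.

Lemma HBM_upper_le1 (R : realType) (T : finType) (lP uP : {set T} -> R) A :
  HBM lP uP -> uP A <= 1.
Proof.
move=> [P0 [a [b [_ _ hA [_ u0] [_ u1]]]]].
have [->|A0] := eqVneq A set0; first by rewrite u0.
have [->|AT] := eqVneq A [set: T]; first by rewrite u1.
by rewrite (hA A A0 AT).2 ge_max ge_min lexx orbT ler01.
Qed.

Lemma HBM_ext_lower (R : realType) (T : finType) (lP uP : {set T} -> R) A :
  HBM lP uP -> coherent_lower lP -> coherent_upper uP ->
  lP A = ext_lower (restr_atoms lP) (restr_atoms uP) A.
Proof.
move=> hHBM cohl cohu; have w0 := HBM_inhabited hHBM.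
have lC := HBM_conjugate A hHBM.
apply/eqP; rewrite /ext_lower /restr_atoms eq_le; apply/andP; split.
  rewrite le_max lC.
  have [lt1|ge1] := ltP (uP (~: A)) 1.
    by rewrite (HBM_upper_sum_atoms hHBM cohu lt1) lexx orbT.
  (* Here [lP A <= 0], so nonnegativity of [lP] on atoms suffices. *)
  apply/orP; left; apply: (@le_trans _ _ 0); first by rewrite subr_le0.
  apply: sumr_ge0 => w _; rewrite (HBM_conjugate [set w] hHBM) subr_ge0.
  exact: HBM_upper_le1 hHBM.
rewrite ge_max coherent_lower_atoms //= lC lerD2l lerN2.
exact: coherent_upper_atoms.
Qed.

Theorem proposition7p4 (R : realType) (n : nat) (T : finType)
  (cardT : #|T| = n) (lP uP : {set T} -> R)
  (hHBM : HBM lP uP)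
  (cohl : coherent_lower lP) (cohu : coherent_upper uP) :
  is_extended_probability_interval (restr_atoms lP) (restr_atoms uP) lP uP.
Proof.
move=> A; split; first exact: HBM_ext_lower.
rewrite /ext_upper -HBM_ext_lower // (HBM_conjugate _ hHBM) setCK.
by rewrite opprB addrC subrK.
Qed.
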